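(* Let $F:\mathcal{C}\to\mathcal{D}$ be a tensor functor between fusion categories over a field $\Bbbk$, with right adjoint $R$. Let $\mathcal{A}=\langle R(\mathbf{1})\rangle$ be the fusion subcategory of $\mathcal{C}$ generated by $R(\mathbf{1})$. Then $$\approx^F\;=\;r^{\mathcal{C},r}_{\mathcal{A}}\;=\;r^{\mathcal{C},l}_{\mathcal{A}}$$ as relations on $\Lambda_{\mathcal{C}}$. In other words, the equivalence classes of $\approx^F$ are the left cosets with respect to $\mathcal{A}$, which coincide with the right cosets with respect to $\mathcal{A}$.
   Context: A fusion category over a field $\Bbbk$ is a $\Bbbk$-linear semisimple rigid monoidal category with finitely many isomorphism classes of simple objects, finite dimensional Hom spaces, such that $\mathrm{End}(S)=\Bbbk$ for every simple object $S$, and whose unit object $\mathbf{1}$ is simple. A fusion subcategory is a full replete monoidal subcategory which is itself a fusion category; $\langle X\rangle$ denotes the smallest fusion subcategory containing the object $X$. $\Lambda_{\mathcal{C}}$ is the set of isomorphism classes of simple objects of $\mathcal{C}$. ''Factor'' means direct summand. A tensor functor is a strong monoidal $\Bbbk$-linear functor; between fusion categories it always has a right adjoint. For $X\in\Lambda_{\mathcal{C}}$ set $X^F=\{Y\in\Lambda_{\mathcal{D}}\mid Y\text{ is a factor of }F(X)\}$. Define a relation on $\Lambda_{\mathcal{C}}$ by $X\sim^F X'\iff X^F\cap X'^F\neq\emptyset$; it is reflexive and symmetric, and $\approx^F$ denotes its transitive closure, an equivalence relation. For a fusion subcategory $\mathcal{A}\subset\mathcal{C}$, $r^{\mathcal{C},r}_{\mathcal{A}}$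 is the equivalence relation on $\Lambda_{\mathcal{C}}$: $X$ is related to $Y$ iff $Y$ is a factor of $X\otimes E$ for some $E\in\Lambda_{\mathcal{A}}$; its classes are the left cosets of $\mathcal{A}$ in $\mathcal{C}$. Likewise $r^{\mathcal{C},l}_{\mathcal{A}}$ is the equivalence relation: $Y$ is a factor of $E\otimes X$ for some $E\in\Lambda_{\mathcal{A}}$; its classes are the right cosets of $\mathcal{A}$ in $\mathcal{C}$. *)

(* Defs.v *)
From Stdlib Require Import Relation_Operators.
From mathcomp Require Import all_boot all_order all_algebra.
Set Implicit Arguments.
Unset Strict Implicit.
Unset Printing Implicit Defensive.
Import GRing.Theory.
Local Open Scope ring_scope.

Declare Scope cat_scope.
Delimit Scope cat_scope with cat.
Reserved Notation "g ∘ f" (at level 39, left associativity).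
Reserved Notation "x ⊗ y" (at level 38, left associativity).
Reserved Notation "f ⊠ g" (at level 38, left associativity).
Reserved Notation "𝟏".

Record linCat (k : fieldType) := LinCat {
  Ob :> Type;
  Hom : Ob -> Ob -> vectType k;
  idm : forall x, Hom x x;
  comp : forall x y z, Hom y z -> Hom x y -> Hom x z;
  comp1m : forall x y (f : Hom x y), comp (idm y) f = f;
  compm1 : forall x y (f : Hom x y), comp f (idm x) = f;
  compA : forall x y z t (h : Hom z t) (g : Hom y z) (f : Hom x y),
    comp h (comp g f) = comp (comp h g) f;
  comp_linl : forall x y z (a : k) (g g' : Hom y z) (f : Hom x y),
    comp (a *: g + g') f = a *: comp g f + comp g' f;
  comp_linr : forall x y z (a : k) (g : Hom y z) (f f' : Hom x y),
    comp g (a *: f + f') = a *: comp g f + comp g f'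
}.
Arguments Hom {k l} _ _.
Arguments idm {k l} _.
Arguments comp {k l x y z} _ _.

Notation "g ∘ f" := (comp g f) : cat_scope.
Local Open Scope cat_scope.

Section LinCatNotions.
Context {k : fieldType} {C : linCat k}.

Record iso (x y : C) := Iso {
  fwd :> Hom x y;
  bwd : Hom y x;
  fwdK : bwd ∘ fwd = idm x;
  bwdK : fwd ∘ bwd = idm y
}.

Definition isomorphic (x y : C) : Prop := inhabited (iso x y).

Definition is_iso (x y : C) (f : Hom x y) : Prop :=
  exists2 g : Hom y x, g ∘ f = idm x & f ∘ g = idm y.

Definition mono (x y : C) (f : Hom x y) : Prop :=
  forall w (g h : Hom w x), f ∘ g = f ∘ h -> g = h.

Definition epi (x y : C) (f : Hom x y) : Prop :=
  forall z (g h : Hom y z), g ∘ f = h ∘ f -> g = h.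

Definition is_zero (x : C) : Prop :=
  (forall y (f g : Hom x y), f = g) /\ (forall y (f g : Hom y x), f = g).

Definition is_biproduct (x y z : C) : Prop :=
  exists (i : Hom x z) (p : Hom z x) (j : Hom y z) (q : Hom z y),
    [/\ p ∘ i = idm x, q ∘ j = idm y, p ∘ j = 0, q ∘ i = 0
      & i ∘ p + j ∘ q = idm z].

Definition is_kernel (w x y : C) (i : Hom w x) (f : Hom x y) : Prop :=
  f ∘ i = 0 /\
  forall t (g : Hom t x), f ∘ g = 0 -> exists! h : Hom t w, i ∘ h = g.

Definition is_cokernel (x y z : C) (p : Hom y z) (f : Hom x y) : Prop :=
  p ∘ f = 0 /\
  forall t (g : Hom y t), g ∘ f = 0 -> exists! h : Hom z t, h ∘ p = g.

Definition factor (y x : C) : Prop := exists z, is_biproduct y z x.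

Definition simple (s : C) : Prop :=
  ~ is_zero s /\
  forall y (i : Hom y s), mono i -> is_zero y \/ is_iso i.

Inductive sum_of_simples : C -> Prop :=
| Sum_zero x : is_zero x -> sum_of_simples x
| Sum_add s x y : simple s -> sum_of_simples x -> is_biproduct s x y ->
    sum_of_simples y.

End LinCatNotions.

Record is_abelian (k : fieldType) (C : linCat k) : Prop := IsAbelian {
  ab_zero : exists x : C, is_zero x;
  ab_sum : forall x y : C, exists z, is_biproduct x y z;
  ab_ker : forall (x y : C) (f : Hom x y),
    exists w (i : Hom w x), is_kernel i f;
  ab_coker : forall (x y : C) (f : Hom x y),
    exists z (p : Hom y z), is_cokernel p f;
  ab_mono : forall (x y : C) (f : Hom x y), mono f ->
    exists z (p : Hom y z), is_kernel f p;
  ab_epi : forall (x y : C) (f : Hom x y), epi f ->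
    exists w (i : Hom w x), is_cokernel f i
}.

Definition is_semisimple (k : fieldType) (C : linCat k) : Prop :=
  is_abelian C /\ forall x : C, sum_of_simples x.

(** The set of isomorphism classes of simple objects, each class being given as
    the predicate "belongs to the class". *)
Record Lambda (k : fieldType) (C : linCat k) := IsoClass {
  in_class :> C -> Prop;
  in_classP : exists s : C,
    simple s /\ forall x, in_class x <-> isomorphic s x
}.

Record monCat (k : fieldType) := MonCat {
  lin_of :> linCat k;
  one : lin_of;
  tens : lin_of -> lin_of -> lin_of;
  tensm : forall x x' y y' : lin_of,
    Hom x x' -> Hom y y' -> Hom (tens x y) (tens x' y');
  assoc : forall x y z, iso (tens (tens x y) z) (tens x (tens y z));
  lunit : forall x, iso (tens one x) x;
  runit : forall x, iso (tens x one) x;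
  tens1 : forall x y, tensm (idm x) (idm y) = idm (tens x y);
  tensM : forall x x' x'' y y' y'' (f' : Hom x' x'') (f : Hom x x')
      (g' : Hom y' y'') (g : Hom y y'),
    tensm (f' ∘ f) (g' ∘ g) = tensm f' g' ∘ tensm f g;
  tens_linl : forall x x' y y' (a : k) (f f' : Hom x x') (g : Hom y y'),
    tensm (a *: f + f') g = a *: tensm f g + tensm f' g;
  tens_linr : forall x x' y y' (a : k) (f : Hom x x') (g g' : Hom y y'),
    tensm f (a *: g + g') = a *: tensm f g + tensm f g';
  assoc_nat : forall x x' y y' z z'
      (f : Hom x x') (g : Hom y y') (h : Hom z z'),
    assoc x' y' z' ∘ tensm (tensm f g) h =
      tensm f (tensm g h) ∘ assoc x y z;
  lunit_nat : forall x y (f : Hom x y),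
    lunit y ∘ tensm (idm one) f = f ∘ lunit x;
  runit_nat : forall x y (f : Hom x y),
    runit y ∘ tensm f (idm one) = f ∘ runit x;
  pentagon : forall x y z t,
    assoc x y (tens z t) ∘ assoc (tens x y) z t =
      tensm (idm x) (assoc y z t) ∘ assoc x (tens y z) t
        ∘ tensm (assoc x y z) (idm t);
  triangle : forall x y,
    tensm (idm x) (lunit y) ∘ assoc x one y = tensm (runit x) (idm y)
}.
Arguments one {k m}.
Arguments tens {k m} _ _.
Arguments tensm {k m x x' y y'} _ _.
Arguments assoc {k m} _ _ _.
Arguments lunit {k m} _.
Arguments runit {k m} _.

Notation "𝟏" := one : cat_scope.
Notation "x ⊗ y" := (tens x y) : cat_scope.
Notation "f ⊠ g" := (tensm f g) : cat_scope.

(** [y] is a left dual of [x], equivalently [x] is a right dual of [y].  The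
    zigzag identities are written without the inverses of the unitors. *)
Definition dual_pair (k : fieldType) (C : monCat k) (y x : C) : Prop :=
  exists (ev : Hom (y ⊗ x) 𝟏) (coev : Hom 𝟏 (x ⊗ y)),
    runit x ∘ (idm x ⊠ ev) ∘ assoc x y x ∘ (coev ⊠ idm x) = lunit x /\
    lunit y ∘ (ev ⊠ idm y) ∘ bwd (assoc y x y) ∘ (idm y ⊠ coev) = runit y.

Definition is_rigid (k : fieldType) (C : monCat k) : Prop :=
  forall x : C, (exists y, dual_pair y x) /\ (exists y, dual_pair x y).

Record is_fusion (k : fieldType) (C : monCat k) : Prop := IsFusion {
  fus_semisimple : is_semisimple C;
  fus_rigid : is_rigid C;
  fus_finite : exists (n : nat) (s : 'I_n -> C),
    forall x : C, simple x -> exists i, isomorphic x (s i);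
  fus_split : forall s : C, simple s -> bijective (fun a : k => a *: idm s);
  fus_unit : simple (𝟏 : C)
}.

Record fusionCat (k : fieldType) := FusionCat {
  mon_of :> monCat k;
  fusionP : is_fusion mon_of
}.

Section Sub.
Variables (k : fieldType) (C : monCat k) (A : C -> Prop).

Definition full_sub : linCat k :=
  @LinCat k {x : C | A x} (fun x y => Hom (sval x) (sval y))
    (fun x => idm (sval x))
    (fun x y z g f => g ∘ f)
    (fun x y => @comp1m k C (sval x) (sval y))
    (fun x y => @compm1 k C (sval x) (sval y))
    (fun x y z t => @compA k C (sval x) (sval y) (sval z) (sval t))
    (fun x y z => @comp_linl k C (sval x) (sval y) (sval z))
    (fun x y z => @comp_linr k C (sval x) (sval y) (sval z)).

Definition sub_iso (x y : full_sub) (f : iso (sval x) (sval y)) : iso x y :=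
  @Iso k full_sub x y (fwd f) (bwd f) (fwdK f) (bwdK f).

Hypothesis A1 : A 𝟏.
Hypothesis At : forall x y, A x -> A y -> A (x ⊗ y).

Definition sub_tens (x y : full_sub) : full_sub :=
  exist A (sval x ⊗ sval y) (At (svalP x) (svalP y)).

Definition full_monoidal_sub : monCat k.
refine (@MonCat k full_sub (exist A 𝟏 A1) sub_tens
  (fun x x' y y' f g => @tensm k C _ _ _ _ f g)
  (fun x y z => @sub_iso (sub_tens (sub_tens x y) z)
     (sub_tens x (sub_tens y z)) (assoc (sval x) (sval y) (sval z)))
  (fun x => @sub_iso (sub_tens (exist A 𝟏 A1) x) x (lunit (sval x)))
  (fun x => @sub_iso (sub_tens x (exist A 𝟏 A1)) x (runit (sval x)))
  _ _ _ _ _ _ _ _ _) => *.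
- exact: tens1.
- exact: tensM.
- exact: tens_linl.
- exact: tens_linr.
- exact: assoc_nat.
- exact: lunit_nat.
- exact: runit_nat.
- exact: pentagon.
- exact: triangle.
Defined.

End Sub.

Definition is_fusion_sub (k : fieldType) (C : monCat k) (A : C -> Prop) :
    Prop :=
  (forall x y, A x -> isomorphic x y -> A y) /\
  exists (A1 : A 𝟏) (At : forall x y, A x -> A y -> A (x ⊗ y)),
    is_fusion (full_monoidal_sub A1 At).

(** The smallest fusion subcategory containing [x], as the intersection of all
    of them (which is again a fusion subcategory). *)
Definition generated (k : fieldType) (C : monCat k) (x : C) : C -> Prop :=
  fun y => forall A : C -> Prop, is_fusion_sub A -> A x -> A y.

Record functor (k : fieldType) (C D : linCat k) := Functor {
  fob :> C -> D;
  fmap : forall x y : C, Hom x y -> Hom (fob x) (fob y);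
  fmap1 : forall x, fmap (idm x) = idm (fob x);
  fmapM : forall x y z (g : Hom y z) (f : Hom x y),
    fmap (g ∘ f) = fmap g ∘ fmap f
}.
Arguments fmap {k C D} _ {x y} _.

Definition fmap_iso (k : fieldType) (C D : linCat k) (F : functor C D)
    (x y : C) (f : iso x y) : iso (F x) (F y).
refine (@Iso k D (F x) (F y) (fmap F f) (fmap F (bwd f)) _ _).
- by rewrite -fmapM fwdK fmap1.
- by rewrite -fmapM bwdK fmap1.
Defined.

Record tensorFunctor (k : fieldType) (C D : monCat k) := TensorFunctor {
  functor_of :> functor C D;
  fmap_lin : forall (x y : C) (a : k) (f g : Hom x y),
    fmap functor_of (a *: f + g) = a *: fmap functor_of f + fmap functor_of g;
  mu : forall x y : C,
    iso (functor_of x ⊗ functor_of y) (functor_of (x ⊗ y));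
  eta : iso 𝟏 (functor_of 𝟏);
  mu_nat : forall (x x' y y' : C) (f : Hom x x') (g : Hom y y'),
    mu x' y' ∘ (fmap functor_of f ⊠ fmap functor_of g) =
      fmap functor_of (f ⊠ g) ∘ mu x y;
  mu_assoc : forall x y z : C,
    fmap functor_of (assoc x y z) ∘ mu (x ⊗ y) z
        ∘ (mu x y ⊠ idm (functor_of z)) =
      mu x (y ⊗ z) ∘ (idm (functor_of x) ⊠ mu y z)
        ∘ assoc (functor_of x) (functor_of y) (functor_of z);
  mu_lunit : forall x : C,
    fmap functor_of (lunit x) ∘ mu 𝟏 x ∘ (eta ⊠ idm (functor_of x)) =
      lunit (functor_of x);
  mu_runit : forall x : C,
    fmap functor_of (runit x) ∘ mu x 𝟏 ∘ (idm (functor_of x) ⊠ eta) =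
      runit (functor_of x)
}.

Record adjunction (k : fieldType) (C D : linCat k)
    (F : functor C D) (R : functor D C) := Adjunction {
  adj : forall x y, Hom (F x) y -> Hom x (R y);
  adj_bij : forall x y, bijective (@adj x y);
  adj_nat : forall x x' y y' (f : Hom x' x) (g : Hom (F x) y) (h : Hom y y'),
    adj (h ∘ g ∘ fmap F f) = fmap R h ∘ adj g ∘ f
}.

(** The conditions imposed on representatives below are invariant under
    isomorphism, so they hold for some representatives iff for all of them. *)

Definition factor_set (k : fieldType) (C D : linCat k) (F : functor C D)
    (X : Lambda C) : Lambda D -> Prop :=
  fun Y => exists x y, [/\ X x, Y y & factor y (F x)].

Definition sim (k : fieldType) (C D : linCat k) (F : functor C D)
    (X X' : Lambda C) : Prop :=
  exists Y : Lambda D, factor_set F X Y /\ factor_set F X' Y.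

Definition approx (k : fieldType) (C D : linCat k) (F : functor C D) :
    Lambda C -> Lambda C -> Prop :=
  clos_trans (Lambda C) (sim F).

(** The classes of [coset_r A] are the left cosets of [A], those of [coset_l A]
    the right cosets. *)
Definition coset_r (k : fieldType) (C : monCat k) (A : C -> Prop)
    (X Y : Lambda C) : Prop :=
  exists (E : Lambda (full_sub A)) x e y,
    [/\ X x, E e, Y y & factor y (x ⊗ sval e)].

Definition coset_l (k : fieldType) (C : monCat k) (A : C -> Prop)
    (X Y : Lambda C) : Prop :=
  exists (E : Lambda (full_sub A)) x e y,
    [/\ X x, E e, Y y & factor y (sval e ⊗ x)].

(* Main.v *)
(** By duality and adjunction, Hom(F X, F Y) is nonzero iff Hom(X, Y ⊗ R 𝟏) is:
    for [Z] a dual of [Y] both are equivalent to Hom(F (Z ⊗ X), 𝟏) ≠ 0.  Since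
    [D] is semisimple, X ~ Y thus means that [X] is a factor of [Y ⊗ R 𝟏].
    Hence X ≈ Y implies that [Y] is a factor of [X ⊗ E] for some simple [E] in
    any [A] containing [R 𝟏] and closed under tensor products and simple
    factors.

    Conversely, if E ~ E' and [Y] is a factor of [X ⊗ E], then [Y] is a factor
    of [X ⊗ E' ⊗ R 𝟏], so Y ~ Z for some factor [Z] of [X ⊗ E'].  Going along a
    chain from [E] to [𝟏], E ≈ 𝟏 implies Y ≈ X.  It follows that the objects all
    of whose simple factors are equivalent to [𝟏] form a fusion subcategory,
    which contains [R 𝟏] and therefore [⟨R 𝟏⟩].

    Right cosets are the left cosets for the reversed tensor products. *)

From Stdlib Require Import Relation_Operators Classical_Prop.
From mathcomp Require Import all_boot all_order all_algebra.
Require Import Defs.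
Set Implicit Arguments.
Unset Strict Implicit.
Unset Printing Implicit Defensive.
Import GRing.Theory.
Local Open Scope ring_scope.
Local Open Scope cat_scope.

(** * Semisimple linear categories *)

Section LinearCategory.
Variables (k : fieldType) (C : linCat k).

Lemma compDl (x y z : C) (g g' : Hom y z) (f : Hom x y) :
  (g + g') ∘ f = g ∘ f + g' ∘ f.
Proof. by have := comp_linl 1 g g' f; rewrite !scale1r. Qed.

Lemma compDr (x y z : C) (g : Hom y z) (f f' : Hom x y) :
  g ∘ (f + f') = g ∘ f + g ∘ f'.
Proof. by have := comp_linr 1 g f f'; rewrite !scale1r. Qed.

Lemma comp0l (x y z : C) (f : Hom x y) : (0 : Hom y z) ∘ f = 0.
Proof. by apply: (addIr (0 ∘ f)); rewrite -compDl !add0r. Qed.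

Lemma comp0r (x y z : C) (g : Hom y z) : g ∘ (0 : Hom x y) = 0.
Proof. by apply: (addIr (g ∘ 0)); rewrite -compDr !add0r. Qed.

Lemma compNl (x y z : C) (g : Hom y z) (f : Hom x y) : (- g) ∘ f = - (g ∘ f).
Proof. by apply/eqP; rewrite -addr_eq0 -compDl addNr comp0l. Qed.

Lemma compNr (x y z : C) (g : Hom y z) (f : Hom x y) : g ∘ (- f) = - (g ∘ f).
Proof. by apply/eqP; rewrite -addr_eq0 -compDr addNr comp0r. Qed.

Lemma compZl (x y z : C) a (g : Hom y z) (f : Hom x y) :
  (a *: g) ∘ f = a *: (g ∘ f).
Proof. by have := comp_linl a g 0 f; rewrite !addr0 comp0l addr0. Qed.

Lemma is_zeroP (x : C) : is_zero x <-> idm x = 0.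
Proof.
split=> [[h _]|e]; first exact: h.
by split=> y f g; [rewrite -[f]compm1 -[g]compm1 e !comp0r
                  |rewrite -[f]comp1m -[g]comp1m e !comp0l].
Qed.

Lemma mono0 (x y : C) (f : Hom x y) :
  (forall w (g : Hom w x), f ∘ g = 0 -> g = 0) -> mono f.
Proof.
move=> h w g g' e; apply/eqP; rewrite -subr_eq0; apply/eqP/h.
by rewrite compDr compNr e addrN.
Qed.

Lemma kernel_mono (w x y : C) (i : Hom w x) (f : Hom x y) :
  is_kernel i f -> mono i.
Proof.
move=> [e u] t g h egh.
have [|m [_ um]] := u t (i ∘ g); first by rewrite compA e comp0l.
by rewrite -(um g) // -(um h).
Qed.

(** In a semisimple category this means that [x] and [y] share a simple summand; for simple [x] it
    says that [x] is a factor of [y]. *)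
Definition hom_nz (x y : C) := exists f : Hom x y, f != 0.
Definition retract (y x : C) :=
  exists (i : Hom y x) (p : Hom x y), p ∘ i = idm y.

Lemma factor_retract (y x : C) : factor y x -> retract y x.
Proof. by move=> [z [i [p [j [q [e _ _ _ _]]]]]]; exists i, p. Qed.

Lemma retract_trans (x y z : C) : retract x y -> retract y z -> retract x z.
Proof.
move=> [i [p e]] [j [q e']]; exists (j ∘ i), (p ∘ q).
by rewrite compA -(compA p) e' compm1.
Qed.

Lemma iso_retract (x y : C) : isomorphic x y -> retract x y.
Proof. by case=> f; exists f, (bwd f); exact: fwdK. Qed.

Lemma isomorphic_refl (x : C) : isomorphic x x.
Proof. by constructor; exists (idm x) (idm x); rewrite comp1m. Qed.

Lemma isomorphic_sym (x y : C) : isomorphic x y -> isomorphic y x.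
Proof. by case=> [[f g e e']]; constructor; exists g f. Qed.

Lemma hom_nz_retractl (x y z : C) : retract x y -> hom_nz x z -> hom_nz y z.
Proof.
move=> [i [p e]] [f nz]; exists (f ∘ p); apply: contra_neq nz => h.
by rewrite -[f]compm1 -e compA h comp0l.
Qed.

Lemma hom_nz_retractr (x y z : C) : retract x y -> hom_nz z x -> hom_nz z y.
Proof.
move=> [i [p e]] [f nz]; exists (i ∘ f); apply: contra_neq nz => h.
by rewrite -[f]comp1m -e -compA h comp0r.
Qed.

Lemma hom_nz_iso (x y x' y' : C) :
  isomorphic x x' -> isomorphic y y' -> hom_nz x y -> hom_nz x' y'.
Proof.
move=> /iso_retract hx /iso_retract hy h.
exact: hom_nz_retractr hy (hom_nz_retractl hx h).
Qed.

Lemma simple_neq0 (s : C) : simple s -> idm s != 0.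
Proof. by case=> nz _; apply/eqP => /is_zeroP. Qed.

Lemma retract_hom_nzl (s x : C) : simple s -> retract s x -> hom_nz s x.
Proof.
move=> hs r; apply: hom_nz_retractr r _.
by exists (idm s); exact: simple_neq0.
Qed.

Lemma simple_iso (s x : C) : simple s -> isomorphic s x -> simple x.
Proof.
move=> [nz hs] [f]; split=> [/is_zeroP e|y i mi].
  apply/nz/is_zeroP.
  by rewrite -(fwdK f) -[f : Hom s x]comp1m e comp0l comp0r.
have [|z|[g e e']] := hs y (bwd f ∘ i); [|by left|right].
  move=> w g h e; apply: mi.
  by rewrite -[i]comp1m -(bwdK f) -!compA (compA _ i g) e -compA.
exists (g ∘ bwd f); first by rewrite -compA.
have -> : i = f ∘ (bwd f ∘ i) by rewrite compA bwdK comp1m.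
by rewrite -compA (compA _ g) e' comp1m bwdK.
Qed.

(** Any additive function of an endomorphism of [x] detects some simple
    summand of [x]; this covers both post- and precomposition, and tensoring. *)
Lemma simple_summand (V : zmodType) (x : C) (phi : Hom x x -> V) :
  sum_of_simples x -> (forall a b, phi (a + b) = phi a + phi b) ->
  phi (idm x) != 0 ->
  exists s (i : Hom s x) (p : Hom x s),
    [/\ simple s, p ∘ i = idm s & phi (i ∘ p) != 0].
Proof.
move=> sx; elim: sx phi => {x} [x z|s x y hs _ IH [i [p [j [q [e1 e2 e3 e4 e]]]]]] phi phiD nz.
  have phi0 : phi 0 = 0 by apply: (addIr (phi 0)); rewrite -phiD !add0r.
  by move: nz; rewrite (proj1 (is_zeroP x) z) phi0 eqxx.
have [|nzi] := eqVneq (phi (i ∘ p)) 0; last by exists s, i, p.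
move=> phi_ip; have [||s' [i' [p' [hs' ep nz']]]] :=
    IH (fun a => phi (j ∘ a ∘ q)).
- by move=> c d; rewrite compDr compDl phiD.
- by apply: contra_neq nz => h; rewrite -e phiD phi_ip add0r -[j]compm1.
exists s', (j ∘ i'), (p' ∘ q); split=> //.
  by rewrite compA -(compA p') e2 compm1.
by move: nz'; rewrite !compA.
Qed.

Definition has_kernels := forall (x y : C) (f : Hom x y),
  exists w (i : Hom w x), is_kernel i f.

(** * Splittings obtained from kernels *)

Section Kernels.
Hypothesis kerC : has_kernels.

(** The complement is the kernel of [p], onto which [idm x - i ∘ p] projects. *)
Lemma retract_complement (x y : C) (i : Hom y x) (p : Hom x y) :
  p ∘ i = idm y ->
  exists z (j : Hom z x) (q : Hom x z),
    [/\ q ∘ j = idm z, p ∘ j = 0, q ∘ i = 0 & i ∘ p + j ∘ q = idm x].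
Proof.
move=> e; have [z [j kj]] := kerC p; have mj := kernel_mono kj.
have [pj u] := kj; have [|q [eq _]] := u _ (idm x - i ∘ p).
  by rewrite compDr compNr compm1 compA e comp1m addrN.
exists z, j, q; split=> //.
- by apply: mj; rewrite compA eq compDl compNl -compA pj comp0r comp1m compm1 subr0.
- by apply: mj; rewrite compA eq compDl compNl -compA e comp1m compm1 comp0r addrN.
- by rewrite eq addrC subrK.
Qed.

Lemma retract_factor (x y : C) : retract y x -> factor y x.
Proof.
move=> [i [p e]]; have [z [j [q [e1 e2 e3 e4]]]] := retract_complement e.
by exists z, i, p, j, q.
Qed.

(** Induction on a decomposition of [y] into a simple [s] and a rest [x]. The kernel [K] of the
    component [p ∘ i] embeds in [x], so the induction hypothesis splits it off [w]; its complement
    [W] embeds in [s], so it is zero or all of [s]. *)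
Lemma mono_split (w y : C) (i : Hom w y) :
  sum_of_simples y -> mono i -> exists r, r ∘ i = idm w.
Proof.
move=> sy; elim: sy w i => {y} [y z|s x y hs _ IH [a [p [b [q [e1 e2 e3 e4 e]]]]]] w i mi.
  have z' : idm w = 0.
    by apply: mi; have [_ h] := z; exact: h.
  by exists 0; rewrite comp0l z'.
have [K [c kc]] := kerC (p ∘ i); have mc := kernel_mono kc.
have [pic uc] := kc; have [|r er] := IH K (q ∘ i ∘ c).
  apply: mono0 => v g h; apply: mc; apply: mi; rewrite !comp0r.
  rewrite -[i ∘ _]comp1m -e compDl -!compA.
  rewrite (_ : q ∘ _ = 0) ?comp0r ?addr0; last by rewrite -h !compA.
  by rewrite (_ : p ∘ _ = 0) ?comp0r //; rewrite !compA pic comp0l.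
have tc : (r ∘ q ∘ i) ∘ c = idm K by rewrite -er !compA.
have [W [m [t [e5 e6 e7 e8]]]] := retract_complement tc.
have [|Wz|[f ef1 ef2]] := hs.2 W (p ∘ i ∘ m).
- apply: mono0 => v g h.
  have [|u [eu _]] := uc v (m ∘ g); first by rewrite compA.
  have u0 : u = 0 by rewrite -[u]comp1m -tc -compA eu compA e6 comp0l.
  by rewrite -[g]comp1m -e5 -compA -eu u0 !comp0r.
- exists (c ∘ r ∘ q); rewrite -e8 (_ : t = 0) ?comp0r ?addr0 ?compA //.
  by case: Wz => _ h; exact: h.
(* [p ∘ i] kills [K], so it factors through the projection [t] onto [W], where [f] inverts it. *)
have pit : p ∘ i = p ∘ i ∘ m ∘ t.
  by rewrite -{1}[p ∘ i]compm1 -e8 compDr !(compA (p ∘ i)) pic comp0l add0r.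
have ft : f ∘ (p ∘ i) = t by rewrite pit compA ef1 comp1m.
exists (c ∘ r ∘ q + m ∘ f ∘ p).
by rewrite compDl -e8 -ft !compA.
Qed.

(** Von Neumann regularity: [f] is monic on a complement of its kernel, and a retraction of that
    restriction, followed by the inclusion of the complement, is a quasi-inverse. *)
Lemma regular (x y : C) (f : Hom x y) :
  sum_of_simples x -> sum_of_simples y -> exists g, f ∘ g ∘ f = f.
Proof.
move=> sx sy; have [K [c kc]] := kerC f; have [fc uc] := kc.
have [r rc] := mono_split sx (kernel_mono kc).
have [W [m [t [e5 e6 e7 e8]]]] := retract_complement rc.
have [|h eh] := @mono_split _ _ (f ∘ m) sy.
  apply: mono0 => v g h.
  have [|u [eu _]] := uc v (m ∘ g); first by rewrite compA.
  have u0 : u = 0 by rewrite -[u]comp1m -rc -compA eu compA e6 comp0l.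
  by rewrite -[g]comp1m -e5 -compA -eu u0 !comp0r.
exists (m ∘ h).
have ef : f = f ∘ m ∘ t.
  by rewrite -{1}[f]compm1 -e8 compDr !compA fc comp0l add0r.
by rewrite compA {2}ef -compA (compA h) eh comp1m -ef.
Qed.
End Kernels.

(** * Maps to and from simple objects *)

Section Semisimple.
Hypothesis ssC : is_semisimple C.
Let sum : forall x : C, sum_of_simples x := ssC.2.
Let kerC : has_kernels := ab_ker ssC.1.

Lemma simple_split_mono (s x : C) (f : Hom s x) :
  simple s -> f != 0 -> exists r, r ∘ f = idm s.
Proof.
move=> hs nz; apply: (mono_split kerC) => //.
have [w [c kc]] := kerC f; have [fc uc] := kc.
have [[_ z]|[g cg gc]] := hs.2 _ _ (kernel_mono kc).
  apply: mono0 => t g e; have [h [<- _]] := uc _ _ e.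
  by rewrite (z _ h 0) comp0r.
by case/negP: nz; rewrite -[f]compm1 -gc compA fc comp0l.
Qed.

(** [simple] speaks of subobjects only, so maps onto [s] are reached through regularity: [f ∘ g] is
    a nonzero idempotent of [s], hence has a left inverse, hence is the identity. *)
Lemma simple_split_epi (s x : C) (f : Hom x s) :
  simple s -> f != 0 -> exists r, f ∘ r = idm s.
Proof.
move=> hs nz; have [g e] := regular kerC f (sum x) (sum s).
have [|r re] := @simple_split_mono _ _ (f ∘ g) hs.
  by apply: contra_neq nz => h; rewrite -e h comp0l.
by exists g; rewrite -[LHS]comp1m -re -compA (compA _ f g) e.
Qed.

Lemma hom_nz_retract (s x : C) : simple s -> hom_nz s x -> retract s x.
Proof. by move=> hs [f /(simple_split_mono hs)[r e]]; exists f, r. Qed.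

(** Schur's lemma: a nonzero map has a retraction and a section, which must agree. *)
Lemma hom_nz_isomorphic (s t : C) :
  simple s -> simple t -> hom_nz s t -> isomorphic s t.
Proof.
move=> hs ht [f nz]; have [r rf] := simple_split_mono hs nz.
have [g fg] := simple_split_epi ht nz.
constructor; exists f r => //.
by rewrite (_ : r = g) // -[r]compm1 -fg compA rf comp1m.
Qed.

Lemma hom_nz_sym (x y : C) : hom_nz x y -> hom_nz y x.
Proof.
move=> [f nz]; have [g e] := regular kerC f (sum x) (sum y).
by exists g; apply: contra_neq nz => h; rewrite -e h comp0r comp0l.
Qed.

Lemma hom_nz_summandl (x y : C) : hom_nz x y ->
  exists s, [/\ simple s, retract s x & hom_nz s y].
Proof.
move=> [f nz].
have [||s [i [p [hs e nz']]]] := simple_summand (phi := fun a => f ∘ a) (sum x).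
- by move=> a b; rewrite compDr.
- by rewrite compm1.
exists s; split=> //; first by exists i, p.
by exists (f ∘ i); apply: contra_neq nz' => h; rewrite compA h comp0l.
Qed.

End Semisimple.
End LinearCategory.

(** * Weak duality and tensor functors *)

Lemma comp_eqr (k : fieldType) (C : linCat k) (x y y' z : C)
    (g : Hom y z) (f : Hom x y) (g' : Hom y' z) (f' : Hom x y') :
  g ∘ f = g' ∘ f' -> forall w (h : Hom w x), g ∘ (f ∘ h) = g' ∘ (f' ∘ h).
Proof. by move=> e w h; rewrite !compA e. Qed.

Lemma comp_idr (k : fieldType) (C : linCat k) (x y : C)
    (g : Hom y x) (f : Hom x y) :
  g ∘ f = idm x -> forall w (h : Hom w x), g ∘ (f ∘ h) = h.
Proof. by move=> e w h; rewrite compA e comp1m. Qed.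

Lemma iso_cancel (k : fieldType) (C : linCat k) (x y z : C)
    (u : iso y z) (v : iso x z) (f : Hom x y) : u ∘ f = v -> is_iso f.
Proof.
move=> e; exists (bwd v ∘ u); first by rewrite -compA e fwdK.
have -> : f = bwd u ∘ v by rewrite -e compA fwdK comp1m.
by rewrite -compA (compA v) bwdK comp1m fwdK.
Qed.

Lemma iso_is_iso (k : fieldType) (C : linCat k) (x y : C) (f : iso x y) :
  is_iso f.
Proof. by exists (bwd f); [exact: fwdK|exact: bwdK]. Qed.

Lemma iso_comp (k : fieldType) (C : linCat k) (x y z : C)
    (g : Hom y z) (f : Hom x y) : is_iso g -> is_iso f -> is_iso (g ∘ f).
Proof.
move=> [g' e1 e2] [f' e3 e4]; exists (f' ∘ g').
  by rewrite -compA (compA g') e1 comp1m.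
by rewrite -compA (compA f) e4 comp1m.
Qed.

Lemma iso_eqr (k : fieldType) (C : linCat k) (x y z : C)
    (u : iso x y) (f : Hom y z) (g : Hom x z) : f ∘ u = g -> is_iso g -> is_iso f.
Proof.
move=> e ig; have -> : f = g ∘ bwd u by rewrite -e -compA bwdK compm1.
by apply: iso_comp => //; exists u; [exact: bwdK|exact: fwdK].
Qed.

(** * Weak duals and transposition of maps *)

Section Monoidal.
Variables (k : fieldType) (C : monCat k).

Lemma tensDl (x x' y y' : C) (f f' : Hom x x') (g : Hom y y') :
  (f + f') ⊠ g = f ⊠ g + f' ⊠ g.
Proof. by have := tens_linl 1 f f' g; rewrite !scale1r. Qed.

Lemma tensDr (x x' y y' : C) (f : Hom x x') (g g' : Hom y y') :
  f ⊠ (g + g') = f ⊠ g + f ⊠ g'.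
Proof. by have := tens_linr 1 f g g'; rewrite !scale1r. Qed.

Lemma tens0r (x x' y y' : C) (f : Hom x x') : f ⊠ (0 : Hom y y') = 0.
Proof. by apply: (addIr (f ⊠ 0)); rewrite -tensDr !add0r. Qed.

Lemma tens_id_lr (x x' y y' : C) (f : Hom x x') (g : Hom y y') :
  (f ⊠ idm y') ∘ (idm x ⊠ g) = f ⊠ g.
Proof. by rewrite -tensM compm1 comp1m. Qed.

Lemma tens_id_rl (x x' y y' : C) (f : Hom x x') (g : Hom y y') :
  (idm x' ⊠ g) ∘ (f ⊠ idm y) = f ⊠ g.
Proof. by rewrite -tensM compm1 comp1m. Qed.

Lemma tens_idl_comp (x y y' y'' : C) (g : Hom y' y'') (f : Hom y y') :
  idm x ⊠ (g ∘ f) = (idm x ⊠ g) ∘ (idm x ⊠ f).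
Proof. by rewrite -tensM comp1m. Qed.

Lemma tens_idr_comp (x y y' y'' : C) (g : Hom y' y'') (f : Hom y y') :
  (g ∘ f) ⊠ idm x = (g ⊠ idm x) ∘ (f ⊠ idm x).
Proof. by rewrite -tensM comp1m. Qed.

Lemma tens_retract (x x' y y' : C) :
  retract x x' -> retract y y' -> retract (x ⊗ y) (x' ⊗ y').
Proof.
move=> [i [p e]] [j [q e']]; exists (i ⊠ j), (p ⊠ q).
by rewrite -tensM e e' tens1.
Qed.

Lemma one_tens_eq0 (x y : C) (f : Hom x y) : idm 𝟏 ⊠ f = 0 -> f = 0.
Proof.
by move=> e; rewrite -[f]compm1 -(bwdK (lunit x)) compA -lunit_nat e comp0r comp0l.
Qed.

Lemma assoc_bwd_nat (x x' y y' z z' : C)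
    (f : Hom x x') (g : Hom y y') (h : Hom z z') :
  bwd (assoc x' y' z') ∘ (f ⊠ (g ⊠ h)) =
    ((f ⊠ g) ⊠ h) ∘ bwd (assoc x y z).
Proof.
rewrite -[LHS]compm1 -(bwdK (assoc x y z)) compA -(compA (bwd _)) -assoc_nat.
by rewrite !compA fwdK comp1m.
Qed.

(** Only the invertibility of the two zigzag composites is needed below; this
    is weaker than duality and is transported by tensor functors without any
    unit coherence. *)
Definition weak_dual (y x : C) : Prop :=
  exists (ev : Hom (y ⊗ x) 𝟏) (coev : Hom 𝟏 (x ⊗ y)),
    is_iso ((idm x ⊠ ev) ∘ assoc x y x ∘ (coev ⊠ idm x)) /\
    is_iso ((ev ⊠ idm y) ∘ bwd (assoc y x y) ∘ (idm y ⊠ coev)).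

Lemma dual_weak_dual (y x : C) : dual_pair y x -> weak_dual y x.
Proof.
move=> [ev [coev [e1 e2]]]; exists ev, coev; split.
  by apply: (@iso_cancel _ _ _ _ _ (runit x) (lunit x)); rewrite -e1 !compA.
by apply: (@iso_cancel _ _ _ _ _ (lunit y) (runit y)); rewrite -e2 !compA.
Qed.

Lemma iso_tensr (x y z : C) (f : Hom x y) : is_iso f -> is_iso (f ⊠ idm z).
Proof.
by move=> [g e e']; exists (g ⊠ idm z); rewrite -tensM ?e ?e' comp1m tens1.
Qed.

(** By the pentagon and naturality, the zigzag acting on [x ⊗ z] is the zigzag of [x] tensored with
    [z], so invertibility carries over. *)
Lemma zigzag1_tens (x y z : C) (ev : Hom (y ⊗ x) 𝟏) (coev : Hom 𝟏 (x ⊗ y)) :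
  (idm x ⊠ ((ev ⊠ idm z) ∘ bwd (assoc y x z))) ∘ assoc x y (x ⊗ z)
    ∘ (coev ⊠ idm (x ⊗ z)) ∘ assoc 𝟏 x z =
  assoc x 𝟏 z
    ∘ (((idm x ⊠ ev) ∘ assoc x y x ∘ (coev ⊠ idm x)) ⊠ idm z).
Proof.
rewrite tens_idl_comp -[idm (x ⊗ z)]tens1 -!compA -assoc_nat.
rewrite (comp_eqr (pentagon x y x z)) -!compA.
rewrite (comp_idr (_ : _ = idm _)); last by rewrite -tensM fwdK comp1m tens1.
by rewrite -(comp_eqr (assoc_nat _ _ _)) !tens_idr_comp.
Qed.

Lemma zigzag2_tens (x y w : C) (ev : Hom (y ⊗ x) 𝟏) (coev : Hom 𝟏 (x ⊗ y)) :
  (ev ⊠ idm (y ⊗ w)) ∘ bwd (assoc y x (y ⊗ w))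
    ∘ (idm y ⊠ (assoc x y w ∘ (coev ⊠ idm w))) ∘ assoc y 𝟏 w =
  assoc 𝟏 y w
    ∘ (((ev ⊠ idm y) ∘ bwd (assoc y x y) ∘ (idm y ⊠ coev)) ⊠ idm w).
Proof.
(* The pentagon with one associator inverted, to match the [bwd] in the second zigzag. *)
have pent' : (idm y ⊠ assoc x y w) ∘ assoc y (x ⊗ y) w =
    assoc y x (y ⊗ w) ∘ (assoc (y ⊗ x) y w ∘ (bwd (assoc y x y) ⊠ idm w)).
  by rewrite compA pentagon -!compA -tensM bwdK comp1m tens1 compm1.
rewrite tens_idl_comp -[idm (y ⊗ w)]tens1 -!compA -assoc_nat.
rewrite (comp_eqr pent') -!compA (comp_idr (fwdK _)).
by rewrite -(comp_eqr (assoc_nat _ _ _)) !tens_idr_comp.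
Qed.

(** Both transposes have trivial kernel: if one vanishes, an invertible zigzag composed with
    [idm 𝟏 ⊠ f] or [idm 𝟏 ⊠ g] vanishes too. *)
Lemma weak_dual_hom_nz (x y w z : C) : weak_dual y x ->
  hom_nz w (x ⊗ z) <-> hom_nz (y ⊗ w) z.
Proof.
move=> [ev [coev [i1 i2]]]; split=> [[f nz]|[g nz]].
  exists (lunit z ∘ (ev ⊠ idm z) ∘ bwd (assoc y x z) ∘ (idm y ⊠ f)).
  apply: contra_neq nz => /(congr1 (fun h => bwd (lunit z) ∘ h)).
  rewrite -!compA (comp_idr (fwdK _)) comp0r => e; apply: one_tens_eq0.
  have [h + _] := iso_eqr (zigzag1_tens z ev coev)
    (iso_comp (iso_is_iso _) (iso_tensr _ i1)).
  move=> eh; rewrite -[LHS]comp1m -eh -compA -[RHS](comp0r _ h); congr (_ ∘ _).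
  rewrite -!compA tens_id_lr -(tens_id_rl coev) -[idm (x ⊗ y)]tens1.
  rewrite (comp_eqr (assoc_nat _ _ _)) compA -tens_idl_comp -compA e.
  by rewrite tens0r comp0l.
exists ((idm x ⊠ g) ∘ (assoc x y w ∘ (coev ⊠ idm w)) ∘ bwd (lunit w)).
apply: contra_neq nz => /(congr1 (fun h => h ∘ lunit w)).
rewrite -!(compA (_ ∘ _)) fwdK compm1 comp0l => e; apply: one_tens_eq0.
have [h _ eh] := iso_eqr (zigzag2_tens w ev coev)
  (iso_comp (iso_is_iso _) (iso_tensr _ i2)).
rewrite -[LHS]compm1 -eh compA -[RHS](comp0l _ h); congr (_ ∘ _).
rewrite !(compA (idm 𝟏 ⊠ g)) tens_id_rl -(tens_id_lr ev) -[idm (y ⊗ x)]tens1.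
rewrite -(compA _ _ (bwd _)) -assoc_bwd_nat -!compA -tens_idl_comp e.
by rewrite tens0r !comp0r.
Qed.

End Monoidal.

Lemma is_iso_inv_uniq (k : fieldType) (C : linCat k) (x y : C)
    (f : Hom x y) (g h : Hom y x) : g ∘ f = idm x -> f ∘ h = idm y -> g = h.
Proof. by move=> e e'; rewrite -[g]compm1 -e' compA e comp1m. Qed.

Definition iso_inv (k : fieldType) (C : linCat k) (x y : C) (f : iso x y) :
  iso y x := Iso (bwdK f) (fwdK f).

(** The reverse monoidal structure exchanges left and right, and so turns every
    statement about [x ⊗ e] into one about [e ⊗ x]. *)
Definition rev_mon (k : fieldType) (C : monCat k) : monCat k.
refine (@MonCat k C 𝟏 (fun x y => y ⊗ x) (fun _ _ _ _ f g => g ⊠ f)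
  (fun x y z => iso_inv (assoc z y x)) runit lunit _ _ _ _ _ _ _ _ _) => *.
- exact: tens1.
- exact: tensM.
- exact: tens_linr.
- exact: tens_linl.
- exact: assoc_bwd_nat.
- exact: runit_nat.
- exact: lunit_nat.
(* The two sides of the reversed pentagon are inverse to the two equal sides of the original one. *)
- apply: (@is_iso_inv_uniq _ _ _ _ (assoc _ _ _ ∘ assoc _ _ _)).
    by rewrite /= -compA (comp_idr (fwdK _)) fwdK.
  rewrite pentagon /= -!compA.
  rewrite (comp_idr (_ : _ = idm _)); last by rewrite -tensM bwdK comp1m tens1.
  by rewrite (comp_idr (bwdK _)) -tensM bwdK comp1m tens1.
- by rewrite /= -triangle -compA bwdK compm1.
Defined.

Lemma rev_fusion (k : fieldType) (C : monCat k) :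
  is_fusion C -> is_fusion (rev_mon C).
Proof.
case=> ss rig fin split un; constructor=> // x.
(* Reversal exchanges the two zigzag identities, hence left and right duals. *)
have dual_rev (u v : C) : dual_pair u v -> @dual_pair k (rev_mon C) v u.
  by move=> [ev [coev [e1 e2]]]; exists ev, coev.
have [[y hy] [z hz]] := rig x.
by split; [exists z|exists y]; exact: dual_rev.
Qed.

(** * Tensor functors preserve weak duals *)

Section TensorFunctor.
Variables (k : fieldType) (C D : monCat k) (F : tensorFunctor C D).

Lemma fmap0 (x y : C) : fmap F (0 : Hom x y) = 0.
Proof.
have := fmap_lin F 1 (0 : Hom x y) 0; rewrite !scale1r add0r => e.
by apply: (addIr (fmap F 0)); rewrite add0r -e.
Qed.

Lemma fmap_is_iso (x y : C) (f : Hom x y) : is_iso f -> is_iso (fmap F f).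
Proof. by move=> [g e e']; exists (fmap F g); rewrite -fmapM ?e ?e' fmap1. Qed.

Lemma fmap_isomorphic (x y : C) : isomorphic x y -> isomorphic (F x) (F y).
Proof. by case=> f; constructor; exact: fmap_iso. Qed.

Lemma mu_assoc_bwd (x y z : C) :
  fmap F (bwd (assoc x y z)) ∘ mu F x (y ⊗ z) ∘ (idm (F x) ⊠ mu F y z) =
    mu F (x ⊗ y) z ∘ (mu F x y ⊠ idm (F z)) ∘ bwd (assoc (F x) (F y) (F z)).
Proof.
rewrite -[LHS]compm1 -(bwdK (assoc (F x) (F y) (F z))) compA; congr (_ ∘ _).
rewrite -!compA (compA (mu F x _)) -mu_assoc -!compA compA -fmapM fwdK fmap1.
by rewrite comp1m.
Qed.

(** The zigzag formed in [D] is the image under [F] of the one in [C], composed on both sides with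
    invertible maps built from [mu] and [eta]. *)
Lemma functor_zigzag1 (x y : C) (ev : Hom (y ⊗ x) 𝟏) (coev : Hom 𝟏 (x ⊗ y)) :
  is_iso ((idm x ⊠ ev) ∘ assoc x y x ∘ (coev ⊠ idm x)) ->
  is_iso ((idm (F x) ⊠ (bwd (eta F) ∘ fmap F ev ∘ mu F y x))
    ∘ assoc (F x) (F y) (F x)
    ∘ ((bwd (mu F x y) ∘ fmap F coev ∘ eta F) ⊠ idm (F x))).
Proof.
move=> hz; rewrite (_ : _ ∘ _ = (idm (F x) ⊠ bwd (eta F)) ∘ bwd (mu F x 𝟏)
  ∘ fmap F ((idm x ⊠ ev) ∘ assoc x y x ∘ (coev ⊠ idm x)) ∘ mu F 𝟏 x
  ∘ (eta F ⊠ idm (F x))).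
  apply: iso_comp; last by apply: iso_tensr; exact: iso_is_iso.
  apply: iso_comp; last exact: iso_is_iso.
  apply: iso_comp; last exact: fmap_is_iso.
  apply: iso_comp; last by exists (mu F x 𝟏); [exact: bwdK|exact: fwdK].
  by exists (idm _ ⊠ eta F); rewrite -tensM ?fwdK ?bwdK comp1m tens1.
have key : (idm (F x) ⊠ mu F y x) ∘ (assoc (F x) (F y) (F x)
    ∘ (bwd (mu F x y) ⊠ idm (F x))) =
    bwd (mu F x (y ⊗ x)) ∘ (fmap F (assoc x y x) ∘ mu F (x ⊗ y) x).
  rewrite -[LHS]comp1m -(fwdK (mu F x (y ⊗ x))) -compA; congr (_ ∘ _).
  rewrite !compA -mu_assoc -!compA -tensM bwdK comp1m tens1 compm1.
  by [].
have ev_nat : (idm (F x) ⊠ fmap F ev) ∘ bwd (mu F x (y ⊗ x)) =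
    bwd (mu F x 𝟏) ∘ fmap F (idm x ⊠ ev).
  rewrite -[LHS]comp1m -(fwdK (mu F x 𝟏)) -compA; congr (_ ∘ _).
  by rewrite compA -[idm (F x)]fmap1 mu_nat -compA bwdK compm1.
rewrite !tens_idl_comp !tens_idr_comp -!compA.
rewrite (compA (assoc (F x) (F y) (F x))) (comp_eqr key) -!compA.
rewrite (comp_eqr ev_nat) !fmapM -!compA; do 3 congr (_ ∘ _).
congr (_ ∘ _); rewrite (comp_eqr (_ : _ = fmap F (coev ⊠ idm x) ∘ mu F 𝟏 x)) //.
by rewrite -mu_nat fmap1.
Qed.

End TensorFunctor.

Definition rev_functor (k : fieldType) (C D : monCat k)
  (F : tensorFunctor C D) : tensorFunctor (rev_mon C) (rev_mon D).
refine (@TensorFunctor k (rev_mon C) (rev_mon D) F (fmap_lin F)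
  (fun x y => mu F y x) (eta F) _ _ (mu_runit F) (mu_lunit F)) => [x x' y y' f g|x y z].
  exact: (mu_nat F g f).
exact: (mu_assoc_bwd F z y x).
Defined.

Lemma functor_weak_dual (k : fieldType) (C D : monCat k)
    (F : tensorFunctor C D) (x y : C) : weak_dual y x -> weak_dual (F y) (F x).
Proof.
move=> [ev [coev [i1 i2]]].
exists (bwd (eta F) ∘ fmap F ev ∘ mu F y x),
  (bwd (mu F x y) ∘ fmap F coev ∘ eta F); split; first exact: functor_zigzag1.
(* The second zigzag is the first one for the reversed tensor products, with [x] and [y]
   exchanged. *)
exact: (@functor_zigzag1 _ _ _ (rev_functor F)).
Qed.

(** * Full subcategories *)

Section Regular.
Variables (k : fieldType) (L : linCat k).

(** When [f ∘ g ∘ f = f], the idempotent [f ∘ g] has the image of [f], and the cokernel of [f] is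
    the projection onto its kernel. A mono [f] is the kernel of [idm y - f ∘ g], an epi [f] the
    cokernel of [idm x - g ∘ f]. *)
Lemma regular_abelian :
  (exists x : L, is_zero x) ->
  (forall x y : L, exists z, is_biproduct x y z) ->
  has_kernels L ->
  (forall (x y : L) (f : Hom x y), exists g, f ∘ g ∘ f = f) ->
  is_abelian L.
Proof.
move=> zL sL kL reg; split=> // x y f; have [g e] := reg x y f.
- have idem : (f ∘ g) ∘ (idm y - f ∘ g) = 0.
    by rewrite compDr compNr compm1 compA e addrN.
  have [K [c kc]] := kL _ _ (f ∘ g); have [c0 uc] := kc.
  have [q [eq _]] := uc _ _ idem.
  exists K, q; split.
    apply: (kernel_mono kc).
    by rewrite compA eq compDl compNl comp1m e addrN comp0r.
  move=> t h hf; exists (h ∘ c); split.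
    by rewrite -compA eq compDr compNr compm1 compA hf comp0l subr0.
  have qc : q ∘ c = idm K.
    apply: (kernel_mono kc).
    by rewrite compA eq compDl compNl c0 subr0 comp1m compm1.
  by move=> u <-; rewrite -compA qc compm1.
- move=> mf; have gf : g ∘ f = idm x by apply: mf; rewrite compA e compm1.
  exists y, (idm y - f ∘ g); split; first by rewrite compDl compNl e comp1m addrN.
  move=> t h; rewrite compDl compNl comp1m => /subr0_eq eh.
  exists (g ∘ h); split; first by rewrite compA -eh.
  by move=> u eu; apply: mf; rewrite compA -eh.
- move=> ef; have fg : f ∘ g = idm y by apply: ef; rewrite e comp1m.
  exists x, (idm x - g ∘ f).
  split; first by rewrite compDr compNr compA e compm1 addrN.
  move=> t h; rewrite compDr compNr compm1 compA => /subr0_eq eh.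
  exists (h ∘ g); split; first by rewrite -eh.
  by move=> u eu; apply: ef; rewrite -eh.
Qed.

End Regular.

Section FullSub.
Variables (k : fieldType) (C : monCat k) (P : C -> Prop).
Hypothesis ssC : is_semisimple C.

(** Subobjects in [C] need not lie in [P], but a simple summand of [s] does, and simplicity in the
    subcategory makes it all of [s]. Conversely, a nonzero map to a simple object of [C] has a
    section, so it is invertible once monic in the subcategory. *)
Lemma simple_full_sub (s : full_sub P) :
  (forall s x : C, simple s -> retract s x -> P x -> P s) ->
  simple s <-> simple (sval s).
Proof.
move=> Psum; split=> [[nz hs]|hs].
  have nz' : idm (sval s) != 0.
    by apply/eqP => e; apply: nz; apply/(is_zeroP (C := full_sub P)).
  have [//|t [i [p [ht e _]]]] := simple_summand (phi := id) (ssC.2 (sval s)) _ nz'.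
  have rt : retract t (sval s) by exists i, p.
  pose t' : full_sub P := exist P t (Psum _ _ ht rt (svalP s)).
  have [|z|[g e1 e2]] := hs t' i.
  - move=> w g h egh.
    have : p ∘ (i ∘ (g : Hom (sval w) t)) = p ∘ (i ∘ (h : Hom (sval w) t)).
      by congr (_ ∘ _); exact: egh.
    by rewrite !compA e !comp1m.
  - by case: (ht.1); apply/is_zeroP; apply/(is_zeroP t').
  - by apply: (simple_iso ht); constructor; exists i g.
split=> [/(is_zeroP (C := full_sub P)) e|y i mi].
  by case: hs => nz _; apply/nz/is_zeroP.
have [i0|nz] := eqVneq (i : Hom (sval y) (sval s)) 0.
  left; apply/(is_zeroP y); apply: mi.
  by rewrite i0 [LHS](comp0l (C := C)) [RHS](comp0l (C := C)).
right; have [r er] := simple_split_epi ssC hs nz.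
by exists r => //; apply: mi; rewrite compA [i ∘ r]er comp1m compm1.
Qed.

Hypothesis Pretract : forall x y : C, retract y x -> P x -> P y.
Hypothesis Pzero : forall x : C, is_zero x -> P x.
Hypothesis Psum : forall x y z : C, P x -> P y -> is_biproduct x y z -> P z.

Lemma full_sub_semisimple : is_semisimple (full_sub P).
Proof.
have [abC sumC] := ssC; have kerC : has_kernels C := ab_ker abC.
split=> [|[x Px]].
  apply: regular_abelian => [|x y|x y f|x y f].
  - have [z hz] := ab_zero abC; exists (exist P z (Pzero hz)).
    by apply/(is_zeroP (C := full_sub P)); apply/(is_zeroP z).
  - have [z hz] := ab_sum abC (sval x) (sval y).
    by exists (exist P z (Psum (svalP x) (svalP y) hz)).
  (* The kernel taken in [C] is a split subobject of [x], hence lies in [P]. *)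
  - have [w [i ki]] := kerC _ _ (f : Hom (sval x) (sval y)).
    have [r er] := mono_split kerC (sumC _) (kernel_mono ki).
    have Pw : P w by apply: Pretract (svalP x); exists i, r.
    exists (exist P w Pw), i; split; first exact: ki.1.
    by move=> t; exact: ki.2.
  - exact: (regular kerC f (sumC (sval x)) (sumC (sval y))).
elim: (sumC x) Px => {x} [x z|s x y hs _ IH b] Px.
  by apply: Sum_zero; apply/(is_zeroP (C := full_sub P)); apply/(is_zeroP x).
have Ps : P s.
  by apply: Pretract Px; exact: factor_retract (ex_intro _ x b).
have Px' : P x.
  by apply: Pretract Px; have [i [p [j [q [_ e _ _ _]]]]] := b; exists j, q.
apply: (@Sum_add _ (full_sub P) (exist P s Ps) (exist P x Px')) => //.
by apply/simple_full_sub => // ? ? _; exact: Pretract.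
Qed.

End FullSub.

(** Closure under summands is not part of the definition, and a simple object of [A] is a priori
    simple only there. Some simple summand [t] of [x] in [A] receives a nonzero map from [s]; as [t]
    has only scalar endomorphisms, the nonzero idempotent of [t] cut out by [s] is the identity, so
    [s] is isomorphic to [t]. *)
Lemma fusion_sub_summand (k : fieldType) (C : monCat k) (A : C -> Prop)
    (s x : C) :
  is_semisimple C -> is_fusion_sub A -> simple s -> retract s x -> A x -> A s.
Proof.
move=> ssC [Aiso [A1 [At [[_ sumA] _ _ splitA _]]]] hs [i [p e]] Ax.
pose x' : full_sub A := exist A x Ax.
have [||t [j [q [ht _]]]] :=
  @simple_summand _ _ _ x' (fun a => p ∘ (a : Hom x x) ∘ i) (sumA x').
- by move=> a b; rewrite compDr compDl.
- by rewrite compm1 e; exact: simple_neq0.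
pose j' : Hom (sval t) x := j; pose q' : Hom x (sval t) := q.
change (p ∘ (j' ∘ q') ∘ i != 0 -> A s) => nz.
have nz' : q' ∘ i != 0.
  by apply: contra_neq nz => h; rewrite -compA -(compA j') h !comp0r.
have [r er] := simple_split_mono ssC hs nz'.
have [g _ gK] := splitA t ht.
have [a ea] : exists a, a *: idm (sval t) = q' ∘ i ∘ r.
  by exists (g (q' ∘ i ∘ r)); exact: gK.
have a1 : a *: (q' ∘ i) = q' ∘ i.
  by rewrite -{1}[q' ∘ i]comp1m -compZl ea -(compA (q' ∘ i)) er compm1.
apply: Aiso (svalP t) _; constructor; exists r (q' ∘ i) => //.
suff -> : q' ∘ i ∘ r = idm (sval t) by [].
rewrite -ea; have /eqP := a1; rewrite -subr_eq0 -{2}[q' ∘ i]scale1r -scalerBl.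
by rewrite scaler_eq0 (negPf nz') orbF subr_eq0 => /eqP ->; rewrite scale1r.
Qed.

(** * The equivalence relation and the cosets *)

Section Classes.
Variables (k : fieldType) (C : linCat k).

Definition class_of (s : C) (hs : simple s) : Lambda C :=
  @IsoClass k C (isomorphic s)
    (ex_intro _ s (conj hs (fun x => iff_refl (isomorphic s x)))).

Lemma class_simple (X : Lambda C) (x : C) : X x -> simple x.
Proof.
by have [s [hs e]] := in_classP X => /e; exact: simple_iso.
Qed.

Lemma class_isomorphic (X : Lambda C) (x y : C) : X x -> X y -> isomorphic x y.
Proof.
have [s [_ e]] := in_classP X; move=> /e[f] /e[g].
constructor; exists (g ∘ bwd f) (f ∘ bwd g).
  by rewrite -compA (compA (bwd g)) fwdK comp1m bwdK.
by rewrite -compA (compA (bwd f)) fwdK comp1m bwdK.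
Qed.

Lemma class_inhabited (X : Lambda C) : exists x, X x.
Proof.
by have [s [_ e]] := in_classP X; exists s; apply/e; exact: isomorphic_refl.
Qed.

End Classes.

Section Link.
Variables (k : fieldType) (C D : linCat k) (F : functor C D).

(** [approx F], transported from isomorphism classes to objects. *)
Definition link (x y : C) := [/\ simple x, simple y & hom_nz (F x) (F y)].
Definition linked := clos_trans C link.

Lemma linked_simple (x y : C) : linked x y -> simple x /\ simple y.
Proof. by elim=> [u v []|u v w _ [? _] _ [_ ?]]. Qed.

Hypothesis ssD : is_semisimple D.

Lemma linked_sym (x y : C) : linked x y -> linked y x.
Proof.
elim=> [u v [hu hv h]|u v w _ h _ h']; last exact: t_trans h' h.
by apply: t_step; split=> //; exact: hom_nz_sym.
Qed.

(** A common simple factor of [F x] and [F y] carries a nonzero map between them; conversely, a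
    nonzero map is nonzero on some simple summand of [F x], which is then a factor of [F y]. *)
Lemma approx_linked (X Y : Lambda C) (x y : C) :
  X x -> Y y -> approx F X Y <-> linked x y.
Proof.
move=> Xx Yy; split.
  move=> h; elim: h x y Xx Yy 
      => {X Y} [X Y [W [[x0 [w0 [Xx0 Ww0 f0]]] [y0 [w1 [Yy0 Ww1 f1]]]]]
               |X Z Y _ IH1 _ IH2] x y Xx Yy.
    apply: t_step; split; [exact: class_simple Xx|exact: class_simple Yy|].
    have fm (U : Lambda C) u v : U u -> U v -> isomorphic (F u) (F v).
      by move=> Uu Uv; have [f] := class_isomorphic Uu Uv; constructor; exact: fmap_iso.
    apply: hom_nz_iso (fm _ _ _ Xx0 Xx) (fm _ _ _ Yy0 Yy) _.
    apply: hom_nz_retractl (factor_retract f0) _.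
    apply: hom_nz_retractr (factor_retract f1) _.
    apply: retract_hom_nzl (class_simple Ww0) _.
    exact: iso_retract (class_isomorphic Ww0 Ww1).
  have [z Zz] := class_inhabited Z.
  exact: t_trans (IH1 _ _ Xx Zz) (IH2 _ _ Zz Yy).
move=> h; elim: h X Y Xx Yy => {x y} [x y [_ _ h]|x z y h IH1 _ IH2] X Y Xx Yy.
  apply: t_step; have [s [hs r h']] := hom_nz_summandl ssD h.
  have kerD : has_kernels D := ab_ker ssD.1.
  have ss : class_of hs s := isomorphic_refl s.
  exists (class_of hs); split; [exists x, s|exists y, s]; split=> //.
    exact: retract_factor.
  by apply: retract_factor => //; exact: hom_nz_retract.
have [_ hz] := linked_simple h.
have zz : class_of hz z := isomorphic_refl z.
exact: t_trans (IH1 _ _ Xx zz) (IH2 _ _ zz Yy).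
Qed.

End Link.

Section Cosets.
Variables (k : fieldType) (C : monCat k) (A : C -> Prop).
Hypothesis ssC : is_semisimple C.
Hypothesis Asum : forall s x : C, simple s -> retract s x -> A x -> A s.

Lemma coset_rP (X Y : Lambda C) (x y : C) : X x -> Y y ->
  coset_r A X Y <-> exists e, [/\ simple e, A e & hom_nz y (x ⊗ e)].
Proof.
move=> Xx Yy; split=> [[E [x0 [e [y0 [Xx0 Ee Yy0 f]]]]]|[e [he Ae h]]].
  exists (sval e); split; [|exact: svalP|].
    by apply/(simple_full_sub ssC e Asum); exact: class_simple Ee.
  apply: hom_nz_retractl (iso_retract (class_isomorphic Yy0 Yy)) _.
  apply: hom_nz_retractr (tens_retract (iso_retract (class_isomorphic Xx0 Xx))
    (iso_retract (isomorphic_refl _))) _.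
  exact: retract_hom_nzl (class_simple Yy0) (factor_retract f).
have he' := (simple_full_sub ssC (exist A e Ae) Asum).2 he.
exists (class_of he'), x, (exist A e Ae), y; split=> //; first exact: isomorphic_refl.
apply: (retract_factor (ab_ker ssC.1)).
exact: (hom_nz_retract ssC (class_simple Yy)).
Qed.

End Cosets.

Section Tens.
Variables (k : fieldType) (C : monCat k).
Hypothesis ssC : is_semisimple C.

Lemma hom_nz_tens_summandr (y x w : C) : hom_nz y (x ⊗ w) ->
  exists e, [/\ simple e, retract e w & hom_nz y (x ⊗ e)].
Proof.
move=> [f nz].
have [||e [i [p [he ep nz']]]] :=
  simple_summand (phi := fun a => (idm x ⊠ a) ∘ f) (ssC.2 w).
- by move=> a b; rewrite tensDr compDl.
- by rewrite tens1 comp1m.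
exists e; split=> //; first by exists i, p.
exists ((idm x ⊠ p) ∘ f); apply: contra_neq nz' => h.
by rewrite tens_idl_comp -compA h comp0r.
Qed.

Lemma assoc_isomorphic (x y z : C) :
  isomorphic ((x ⊗ y) ⊗ z) (x ⊗ (y ⊗ z)).
Proof. by constructor; exact: assoc. Qed.

Lemma runit_isomorphic (x : C) : isomorphic (x ⊗ 𝟏) x.
Proof. by constructor; exact: runit. Qed.

End Tens.

(** * Links expressed through [R 𝟏] *)

Section FunctorLinks.
Variables (k : fieldType) (C D : monCat k) (F : tensorFunctor C D).
Variables (R : functor D C) (FR : adjunction F R).
Hypotheses (fusC : is_fusion C) (fusD : is_fusion D).
Let ssC := fus_semisimple fusC.
Let ssD := fus_semisimple fusD.

Lemma hom_nz_adj (x : C) (y : D) : hom_nz (F x) y <-> hom_nz x (R y).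
Proof.
(* [adj] and [R] are not assumed linear; naturality along the zero endomorphism of [x] gives the
   claim. *)
have adj0 : adj FR (0 : Hom (F x) y) = 0.
  have := adj_nat FR (0 : Hom x x) 0 (idm y).
  by rewrite comp0r fmap0 comp0r comp0r.
have [g gK Kg] := adj_bij FR x y.
split=> [[f nz]|[f nz]]; [exists (adj FR f)|exists (g f)].
  by apply: contra_neq nz => h; rewrite -[f]gK h -adj0 gK.
by apply: contra_neq nz => h; rewrite -[f]Kg h adj0.
Qed.

Lemma hom_nz_functor (x y : C) : hom_nz (F x) (F y) <-> hom_nz x (y ⊗ R 𝟏).
Proof.
have [[z dz] _] := fus_rigid fusC y; have wz := dual_weak_dual dz.
have wF := functor_weak_dual F wz.
have r := runit_isomorphic (F y).
have m : isomorphic (F z ⊗ F x) (F (z ⊗ x)) by constructor; exact: mu.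
split=> h.
  apply/(weak_dual_hom_nz _ _ wz)/hom_nz_adj.
  apply: hom_nz_iso m (isomorphic_refl _) _.
  apply/(weak_dual_hom_nz _ _ wF).
  exact: hom_nz_iso (isomorphic_refl _) (isomorphic_sym r) h.
apply: hom_nz_iso (isomorphic_refl _) r _.
apply/(weak_dual_hom_nz _ _ wF).
apply: hom_nz_iso (isomorphic_sym m) (isomorphic_refl _) _.
by apply/hom_nz_adj/(weak_dual_hom_nz _ _ wz).
Qed.

(** Since [F 𝟏] is isomorphic to [𝟏], the adjunction makes [𝟏] a summand of [R 𝟏], and so [x] a
    summand of [x ⊗ R 𝟏]. This makes [link] reflexive on simple objects. *)
Lemma functor_neq0 (x : C) : simple x -> hom_nz (F x) (F x).
Proof.
move=> hx; apply/hom_nz_functor.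
have r1 : retract 𝟏 (R 𝟏).
  apply: (hom_nz_retract ssC (fus_unit fusC)); apply/hom_nz_adj.
  have r : retract (𝟏 : D) (F 𝟏) by apply: iso_retract; constructor; exact: eta.
  by apply: hom_nz_sym ssD _ _ _; exact: retract_hom_nzl (fus_unit fusD) r.
apply: retract_hom_nzl => //.
apply: retract_trans (tens_retract (iso_retract (isomorphic_refl x)) r1).
exact: iso_retract (isomorphic_sym (runit_isomorphic x)).
Qed.

Lemma linked_iso (x y : C) : simple x -> isomorphic x y -> linked F x y.
Proof.
move=> hx e; apply: t_step; split=> //; first exact: simple_iso e.
apply: hom_nz_iso (isomorphic_refl _) (fmap_isomorphic F e) _.
exact: functor_neq0.
Qed.

Lemma hom_nz_functor_summand (x : D) (y : C) : hom_nz x (F y) ->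
  exists z, [/\ simple z, retract z y & hom_nz x (F z)].
Proof.
move=> [f nz].
have [||z [i [p [hz e nz']]]] :=
  simple_summand (phi := fun a => fmap F a ∘ f) (ssC.2 y).
- move=> a b; have := fmap_lin F 1 a b; rewrite !scale1r => ->.
  by rewrite compDl.
- by rewrite fmap1 comp1m.
exists z; split=> //; first by exists i, p.
exists (fmap F p ∘ f); apply: contra_neq nz' => h.
by rewrite fmapM -compA h comp0r.
Qed.

Lemma linked_tens (e e' x y : C) : linked F e e' -> simple y ->
  hom_nz y (x ⊗ e) -> exists2 z, linked F y z & hom_nz z (x ⊗ e').
Proof.
(* [y] must vary in the induction, since each link replaces it by another simple object. *)
move=> h; elim: h y => {e e'} [e e' [he he' h]|e e1 e' _ IH1 _ IH2] y hy n.
  have /hom_nz_functor/(hom_nz_retract ssC he) r := h.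
  have n' : hom_nz y ((x ⊗ e') ⊗ R 𝟏).
    apply: hom_nz_iso (isomorphic_refl _) (isomorphic_sym (assoc_isomorphic _ _ _)) _.
    exact: hom_nz_retractr (tens_retract (iso_retract (isomorphic_refl _)) r) n.
  have /hom_nz_functor_summand[z [hz r' nz]] :=
    (hom_nz_functor y (x ⊗ e')).2 n'.
  by exists z; [exact: t_step|exact: retract_hom_nzl].
have [z lz nz] := IH1 y hy n; have [_ hz] := linked_simple lz.
have [t lt nt] := IH2 z hz nz.
by exists t => //; exact: t_trans lz lt.
Qed.

(** Following the chain to [𝟏] ends at a simple factor of [x ⊗ 𝟏], which is [x] up to
    isomorphism. *)
Lemma linked_factor_r (e x y : C) : linked F e 𝟏 -> simple x -> simple y ->
  hom_nz y (x ⊗ e) -> linked F y x.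
Proof.
move=> le hx hy n; have [z lz nz] := linked_tens le hy n.
have [_ hz] := linked_simple lz.
apply: t_trans lz _; apply: linked_iso => //.
apply: (hom_nz_isomorphic ssC) => //.
exact: hom_nz_iso (isomorphic_refl _) (runit_isomorphic x) nz.
Qed.

End FunctorLinks.

(** * Linkage classes as cosets *)

Section RightCosets.
Variables (k : fieldType) (C D : monCat k) (F : tensorFunctor C D).
Variables (R : functor D C) (FR : adjunction F R).
Hypotheses (fusC : is_fusion C) (fusD : is_fusion D).
Variable A : C -> Prop.
Hypothesis Asum : forall s x : C, simple s -> retract s x -> A x -> A s.
Hypothesis Atens : forall x y, A x -> A y -> A (x ⊗ y).
Hypothesis AR : A (R 𝟏).
Hypothesis Alinked : forall s, simple s -> A s -> linked F 𝟏 s.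
Let ssC := fus_semisimple fusC.
Let ssD := fus_semisimple fusD.

(** Keeping [A] abstract, with only these closure properties, lets the statement be applied to the
    reversed tensor products as well. *)
Lemma approx_coset_r (X Y : Lambda C) : approx F X Y <-> coset_r A X Y.
Proof.
have [x Xx] := class_inhabited X; have [y Yy] := class_inhabited Y.
rewrite (approx_linked F ssD Xx Yy) (coset_rP ssC Asum Xx Yy).
split=> [|[e [he Ae n]]]; last first.
  apply: (linked_sym ssD).
  apply: (linked_factor_r FR fusC fusD) n.
  - by apply: (linked_sym ssD); exact: Alinked.
  - exact: class_simple Xx.
  - exact: class_simple Yy.
elim=> {X Y x y Xx Yy} [x y [hx hy h]|x y z h [e [he Ae n]] _ [e' [he' Ae' n']]].
  have /(hom_nz_functor FR fusC)/(hom_nz_tens_summandr ssC)[e [he r n]] :=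
    hom_nz_sym ssD h.
  by exists e; split=> //; exact: Asum r AR.
have r : retract y (x ⊗ e).
  by apply: (hom_nz_retract ssC) n; exact: (linked_simple h).2.
(* Two consecutive chains combine: [z] occurs in [y ⊗ e'] and [y] in [x ⊗ e], so a simple summand of
   [e ⊗ e'] relates [x] to [z]. *)
have : hom_nz z (x ⊗ (e ⊗ e')).
  apply: hom_nz_iso (isomorphic_refl _) (assoc_isomorphic _ _ _) _.
  exact: hom_nz_retractr (tens_retract r (iso_retract (isomorphic_refl _))) n'.
move=> /(hom_nz_tens_summandr ssC)[t [ht rt nt]].
by exists t; split=> //; apply: Asum rt (Atens Ae Ae').
Qed.

End RightCosets.

(** * Closure properties of the objects linked to the unit *)

Section LinkedToUnit.
Variables (k : fieldType) (C D : monCat k) (F : tensorFunctor C D).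
Variables (R : functor D C) (FR : adjunction F R).
Hypotheses (fusC : is_fusion C) (fusD : is_fusion D).
Let ssC := fus_semisimple fusC.
Let ssD := fus_semisimple fusD.

Lemma linked_factor_l (e x y : C) : linked F e 𝟏 -> simple x -> simple y ->
  hom_nz y (e ⊗ x) -> linked F y x.
Proof.
exact: (@linked_factor_r _ _ _ (rev_functor F) R FR
  (rev_fusion fusC) (rev_fusion fusD) e x y).
Qed.

Definition linked_to_unit (x : C) : Prop :=
  forall s, simple s -> hom_nz s x -> linked F 𝟏 s.

Lemma linked_to_unit_iso (x y : C) :
  linked_to_unit x -> isomorphic x y -> linked_to_unit y.
Proof.
move=> h /isomorphic_sym/iso_retract r s hs n; apply: h => //.
exact: hom_nz_retractr r n.
Qed.

Lemma linked_to_unit_one : linked_to_unit 𝟏.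
Proof.
move=> s hs n; apply: (linked_sym ssD).
apply: (linked_iso FR fusC fusD hs).
exact: (hom_nz_isomorphic ssC hs (fus_unit fusC) n).
Qed.

(** A simple factor [s] of [x ⊗ y] occurs in [f ⊗ e] for simple factors [f] of [x] and [e] of [y];
    as [e] is linked to [𝟏], [s] is linked to [f], and [f] to [𝟏]. *)
Lemma linked_to_unit_tens (x y : C) :
  linked_to_unit x -> linked_to_unit y -> linked_to_unit (x ⊗ y).
Proof.
move=> hx hy s hs /(hom_nz_tens_summandr ssC)[e [he re n]].
have [f [hf rf {}n]] : exists f, [/\ simple f, retract f x & hom_nz s (f ⊗ e)].
  exact: (@hom_nz_tens_summandr _ (rev_mon C) ssC s e x).
apply: t_trans (hx f hf (retract_hom_nzl hf rf)) _.
apply: (linked_sym ssD); apply: (linked_factor_r FR fusC fusD) n => //.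
by apply: (linked_sym ssD); apply: hy => //; exact: retract_hom_nzl.
Qed.

(** By adjunction a nonzero map from [s] to [R 𝟏] gives one from [F s] to [𝟏], hence to [F 𝟏]: a
    single link. *)
Lemma linked_to_unit_adj : linked_to_unit (R 𝟏).
Proof.
move=> s hs n; apply: (linked_sym ssD); apply: t_step; split=> //.
  exact: fus_unit.
apply: hom_nz_retractr ((hom_nz_adj FR s 𝟏).2 n).
by apply: iso_retract; constructor; exact: eta.
Qed.

(** A simple factor [t] of a dual [y] of [x] has [𝟏] as a factor of [x ⊗ t], so
    [𝟏 ≈ t] follows from the coset lemmas without dualizing [≈] itself. *)
Lemma linked_to_unit_dual (x y : C) :
  linked_to_unit x -> dual_pair y x -> linked_to_unit y.
Proof.
move=> hx /dual_weak_dual w t ht /(hom_nz_sym ssC)[f nz].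
have n : hom_nz 𝟏 (x ⊗ t).
  apply/(weak_dual_hom_nz _ _ w); exists (f ∘ runit y).
  by apply: contra_neq nz => h; rewrite -[f]compm1 -(bwdK (runit y)) compA h comp0l.
have [e [he re {}n]] : exists e, [/\ simple e, retract e x & hom_nz 𝟏 (e ⊗ t)].
  exact: (@hom_nz_tens_summandr _ (rev_mon C) ssC 𝟏 t x).
apply: (linked_factor_l _ ht (fus_unit fusC)) n.
by apply: (linked_sym ssD); apply: hx => //; exact: retract_hom_nzl.
Qed.

Lemma linked_to_unit_retract (x y : C) :
  retract y x -> linked_to_unit x -> linked_to_unit y.
Proof. by move=> r h s hs n; apply: h => //; exact: hom_nz_retractr r n. Qed.

Lemma linked_to_unit_zero (x : C) : is_zero x -> linked_to_unit x.
Proof. by move=> [_ z] s _ [f]; rewrite (z _ f 0) eqxx. Qed.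

Lemma linked_to_unit_sum (x y z : C) :
  linked_to_unit x -> linked_to_unit y -> is_biproduct x y z ->
  linked_to_unit z.
Proof.
move=> hx hy [i [p [j [q [_ _ _ _ e]]]]] s hs [f nz].
have [pf|] := eqVneq (p ∘ f) 0; last by move=> n; apply: hx => //; exists (p ∘ f).
apply: hy => //; exists (q ∘ f); apply: contra_neq nz => qf.
by rewrite -[f]comp1m -e compDl -!compA pf qf !comp0r addr0.
Qed.

End LinkedToUnit.

(** * The fusion subcategory of objects linked to the unit *)

Section LinkedFusion.
Variables (k : fieldType) (C D : monCat k) (F : tensorFunctor C D).
Variables (R : functor D C) (FR : adjunction F R).
Hypotheses (fusC : is_fusion C) (fusD : is_fusion D).
Let ssC := fus_semisimple fusC.
Let ssD := fus_semisimple fusD.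
Notation B := (linked_to_unit F).

Lemma linked_to_unit_dualr (x y : C) : B x -> dual_pair x y -> B y.
Proof.
move=> hx [ev [coev [e1 e2]]].
apply: (@linked_to_unit_dual _ _ _ (rev_functor F) R FR
  (rev_fusion fusC) (rev_fusion fusD) x y hx).
by exists ev, coev.
Qed.

Lemma linked_to_unit_fusion : is_fusion_sub B.
Proof.
split; first exact: linked_to_unit_iso.
have B1 := linked_to_unit_one FR fusC fusD.
exists B1, (linked_to_unit_tens FR fusC fusD).
have simB (s : full_sub B) : simple s <-> simple (sval s).
  apply: (simple_full_sub ssC) => u x _; exact: linked_to_unit_retract.
split.
- apply: (full_sub_semisimple ssC).
  + by move=> x y; exact: linked_to_unit_retract.
  + exact: linked_to_unit_zero.
  + exact: linked_to_unit_sum.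
- move=> [x Bx]; have [[y dy] [z dz]] := fus_rigid fusC x; split.
    exists (exist B y (linked_to_unit_dual FR fusC fusD Bx dy)).
    exact: dy.
  exists (exist B z (linked_to_unit_dualr Bx dz)).
  exact: dz.
- have [n [s hs]] := fus_finite fusC.
  (* Representatives of simple objects outside [B] are replaced by the default [𝟏]. *)
  have /fin_all_exists[s' hs'] (i : 'I_n) :
      exists y : full_sub B, B (s i) -> sval y = s i.
    have [Bsi|nB] := classic (B (s i)); first by exists (exist B (s i) Bsi).
    by exists (exist B 𝟏 B1).
  exists n, s' => x /simB/hs[i hi]; exists i.
  (* An [s i] isomorphic to an object of [B] lies in [B], so the default is not taken here. *)
  have e := hs' i (linked_to_unit_iso (svalP x) hi); rewrite -e in hi.
  by have [f] := hi; constructor; exact: (@sub_iso _ _ _ x (s' i) f).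
- by move=> s /simB; exact: (fus_split fusC).
- by apply/(simB (exist B 𝟏 B1)); exact: fus_unit fusC.
Qed.

End LinkedFusion.

Theorem proposition3p3 (k : fieldType) (C D : fusionCat k)
    (F : tensorFunctor C D) (R : functor D C) (FR : adjunction F R) :
  (forall X Y : Lambda C,
     approx F X Y <-> coset_r (generated (R 𝟏)) X Y) /\
  (forall X Y : Lambda C,
     coset_r (generated (R 𝟏)) X Y <-> coset_l (generated (R 𝟏)) X Y).
Proof.
have fC := fusionP C; have fD := fusionP D; have ssC := fus_semisimple fC.
set A := generated (R 𝟏).
have Asum (s x : C) : simple s -> retract s x -> A x -> A s.
  move=> hs r Ax B fB BR.
  exact: fusion_sub_summand ssC fB hs r (Ax B fB BR).
have Atens (x y : C) : A x -> A y -> A (x ⊗ y).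
  by move=> Ax Ay B fB BR; have [_ [_ [Bt _]]] := fB; apply: Bt; [exact: Ax|exact: Ay].
have AR : A (R 𝟏) by [].
have Alinked (s : C) : simple s -> A s -> linked F 𝟏 s.
  (* The objects linked to [𝟏] form one of the fusion subcategories intersected in [A]. *)
  move=> hs As; apply: (As _ (linked_to_unit_fusion FR fC fD)) => //.
    exact: linked_to_unit_adj.
  by exists (idm s); exact: simple_neq0.
have approx_r := approx_coset_r FR fC fD Asum Atens AR Alinked.
split=> // X Y; rewrite -approx_r.
(* Reversal leaves [approx F] unchanged and turns [coset_r] into [coset_l]; [A] is kept, being
   closed under the reversed product too. *)
exact: (@approx_coset_r _ _ _ (rev_functor F) R FR (rev_fusion fC)
  (rev_fusion fD) A Asum (fun x y Ax Ay => Atens y x Ay Ax) AR Alinked X Y).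
Qed.
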